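(* Let $q=mf+1$ be a power of a prime $p$, with $m,f$ positive integers. Suppose $f+1=\lambda m$ with $\lambda$ an integer, and let $\chi$ be a multiplicative character of order $m$ on $\mathbb{F}_q$. Then $M_{q,m}$ is a $(q,f+1,\lambda)$-difference set in $\mathbb{F}_q$ if and only if $$\sum_{\substack{t=1\\ t\neq s}}^{m-1}\chi^t(-1)G_q(\chi^t)G_q(\chi^{s-t})=(1-m)(1+\chi^s(-1))G_q(\chi^s),\quad s=1,\dots,m-1.$$
   Context: $H_{q,m}$ denotes the set of nonzero $m$th powers in $\mathbb{F}_q$ and $M_{q,m}=H_{q,m}\cup\{0\}$. A subset $D\subseteq\mathbb{F}_q$ of size $k$ is a $(q,k,\lambda)$-difference set in $\mathbb{F}_q$ if for each nonzero $a\in\mathbb{F}_q$ there are exactly $\lambda$ ordered pairs $(x,y)\in D\times D$ with $x-y=a$. A multiplicative character on $\mathbb{F}_q$ is a homomorphism $\mathbb{F}_q^*\to\mathbb{C}^*$ extended to $0$ by the value $1$ if the character is trivial and $0$ if it is nontrivial. For $s\in\mathbb{Z}$, $\chi^s$ is the $s$th power of $\chi$ as a character of $\mathbb{F}_q^*$, extended to $0$ by this same rule. The Gauss sum of a multiplicative character $\chi$ on $\mathbb{F}_q$ is $G_q(\chi)=\sum_{\alpha\in\mathbb{F}_q}\chi(\alpha)\zeta_p^{\mathrm{tr}(\alpha)}$, where $\zeta_p=e^{2\pi i/p}$ and $\mathrm{tr}$ is the trace map from $\mathbb{F}_q$ to $\mathbb{F}_p$. *)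

(* Defs.v *)
From HB Require Import structures.
From mathcomp Require Import all_boot all_order all_algebra all_fingroup all_field.
From mathcomp Require Import complex.
From mathcomp Require Import reals trigo.

Set Implicit Arguments.
Unset Strict Implicit.
Unset Printing Implicit Defensive.

Import Order.TTheory GRing.Theory Num.Theory.
Local Open Scope ring_scope.
Local Open Scope complex_scope.

Section DifferenceSets.
Variable F : finFieldType.

Definition nz_powers (m : nat) : {set F} := [set x ^+ m | x : F & x != 0].

Definition powers (m : nat) : {set F} := 0 |: nz_powers m.

Definition is_difference_set (q k lam : nat) (D : {set F}) : Prop :=
  [/\ #|F| = q, #|D| = k &
      forall a : F, a != 0 ->
        #|[set xy in setX D D | xy.1 - xy.2 == a]| = lam].

End DifferenceSets.

Section MultiplicativeCharacters.
Variables (R : realType) (F : finFieldType).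

Record mulchar := MulChar {
  mulchar_fun : {unit F} -> R[i];
  mulchar_neq0 : forall u, mulchar_fun u != 0;
  mulcharM : forall u v,
    mulchar_fun (u * v)%g = mulchar_fun u * mulchar_fun v
}.

Implicit Type chi : mulchar.

Definition mulchar_trivial chi : bool := [forall u, mulchar_fun chi u == 1].

(* insub a is None exactly when a = 0 *)
Definition mulchar_ext chi (a : F) : R[i] :=
  if (insub a : option {unit F}) is Some u then mulchar_fun chi u
  else (mulchar_trivial chi)%:R.

Lemma mulchar_pow_neq0 chi (s : int) u : mulchar_fun chi u ^ s != 0.
Proof. exact/expfz_neq0/mulchar_neq0. Qed.

Lemma mulchar_powM chi (s : int) u v :
  mulchar_fun chi (u * v)%g ^ s = mulchar_fun chi u ^ s * mulchar_fun chi v ^ s.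
Proof. by rewrite mulcharM expfzMl. Qed.

Definition mulchar_pow chi (s : int) : mulchar :=
  MulChar (mulchar_pow_neq0 chi s) (mulchar_powM chi s).

Definition mulchar_has_order chi (m : nat) : Prop :=
  [/\ (0 < m)%N, mulchar_trivial (mulchar_pow chi m) &
      forall k : nat, (0 < k < m)%N -> ~~ mulchar_trivial (mulchar_pow chi k)].

End MultiplicativeCharacters.

Coercion mulchar_ext : mulchar >-> Funclass.

Section Trace.
Variables (F : finFieldType) (p : nat) (hp : p \in [pchar F]).

(* F seen as a field extension of 'F_p *)
Local Notation L := (pPrimeCharType hp).

Lemma galTrace_in_Fp (a : F) :
  exists c : 'F_p, c%:A == galTrace 1%AS {:L}%AS (a : L).
Proof.
have /vlineP[c ->] : galTrace 1%AS {:L}%AS (a : L) \in 1%VS.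
  by apply: mem_galTrace; [exact: (finField_galois (sub1v _)) | exact: memvf].
by exists c.
Qed.

Definition absolute_trace (a : F) : 'F_p := xchoose (galTrace_in_Fp a).

End Trace.

Section GaussSums.
Variable R : realType.

Definition zeta (p : nat) : R[i] :=
  cos (2 * pi / p%:R) +i* sin (2 * pi / p%:R).

(* The exponent is the representative in [0, p) of the trace in 'F_p. *)
Definition gauss_sum (F : finFieldType) (p : nat) (hp : p \in [pchar F])
    (chi : mulchar R F) : R[i] :=
  \sum_(a : F) chi a * zeta p ^+ (absolute_trace hp a : nat).

End GaussSums.

(* Main.v *)
Require Import Defs.
From mathcomp Require Import all_boot all_order all_algebra all_fingroup.
From mathcomp Require Import all_solvable all_field.
From mathcomp Require Import complex reals trigo ring lra.

(** Write H for the group of nonzero m-th powers, D = {0} u H, psi for the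
    additive character a |-> zeta_p^(tr a), G_s for the Gauss sum of chi^s,
    and N(a) for the number of pairs (x, y) in D x D with x - y = a.

    Since D H = D, the function N is constant on the cosets of H in F^*. The
    kernel of chi is H, so the characters of F^* / H are the powers of chi, and
    N is constant on F^* exactly when its Fourier coefficients
      sum_a N(a) chi^(-s)(a),  0 < s < m,
    all vanish ([nz_powers_fourier_inversion]). The constant is then
    forced: the q - 1 = m f values of N add up to (f + 1) f = lam m f, so
    N = lam. It remains to translate the vanishing of the s-th coefficient.

    Put A_s = sum_(h in H) chi^(-s)(1 - h). Splitting D into 0 and H, and
    factoring x out of x - y for x, y in H, the s-th coefficient is
      f (A_s + 1 + chi^s(-1))        ([difference_count_fourier]).
    On the other side, expand the product of two Gauss sums, replace the first
    variable x by - x y, and sum over all t < m: the geometric sum of the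
    chi^t(x) is m times the indicator of H, and what is left is a Gauss sum of
    chi^s twisted by 1 - h for each h in H. With the Gauss sum of the trivial
    character taken over F^*, where it is -1, this reads
      sum_(t < m) chi^t(-1) G_t G_(s-t) = m A_s G_s
    ([unit_gauss_sum_convolution]). Removing the terms t = 0 and t = s, which
    are - G_s and - chi^s(-1) G_s, turns the right-hand side into
    (m A_s + 1 + chi^s(-1)) G_s ([gauss_sum_convolution]). As G_s is nonzero,
    this equals (1 - m) (1 + chi^s(-1)) G_s iff A_s + 1 + chi^s(-1) = 0. *)

Set Implicit Arguments.
Unset Strict Implicit.
Unset Printing Implicit Defensive.

Import Order.TTheory GRing.Theory Num.Theory.
Local Open Scope ring_scope.
Local Open Scope complex_scope.

(** * The root of unity zeta *)

Section Zeta.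
Variable R : realType.
Implicit Types (x : R) (p : nat).

Lemma expi_exp x n :
  (cos x +i* sin x) ^+ n = cos (x *+ n) +i* sin (x *+ n) :> R[i].
Proof.
elim: n => [|n IHn]; first by rewrite mulr0n cos0 sin0.
rewrite exprS IHn mulrS cosD sinD.
by apply/eqP; rewrite eq_complex /= eqxx addrC eqxx.
Qed.

Lemma zeta_exp_order p : (0 < p)%N -> zeta R p ^+ p = 1.
Proof.
move=> p_gt0; have p_neq0 : p%:R != 0 :> R by rewrite pnatr_eq0 -lt0n.
have period : (2 * pi / p%:R) *+ p = pi *+ 2 :> R.
  by rewrite -mulr_natr divfK // mulr_natl.
by rewrite expi_exp period cos2pi sin_mulr2n sinpi mulr0 mul0rn.
Qed.

(** The real part of zeta is 1 - 2 sin(pi/p)^2, and 0 < pi/p < pi. *)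
Lemma zeta_neq1 p : (1 < p)%N -> zeta R p != 1.
Proof.
move=> p_gt1; have p_gt0 : 0 < p%:R :> R by rewrite ltr0n ltnW.
apply/eqP => /(congr1 (@complex.Re R)) /=.
have -> : 2 * pi / p%:R = (pi / p%:R) *+ 2 :> R by rewrite -mulrA mulr_natl.
rewrite cos_mulr2n cos2sin2 => cos1.
have sin_gt0 : 0 < sin (pi / p%:R : R).
  apply: sin_gt0_pi; rewrite divr_gt0 ?pi_gt0 //=.
  by rewrite ltr_pdivrMr // ltr_pMr ?pi_gt0 // ltr1n.
have : sin (pi / p%:R : R) ^+ 2 = 0 by lra.
by move/eqP; rewrite expf_eq0 /= gt_eqF.
Qed.

Lemma zeta_primitive p : prime p -> p.-primitive_root (zeta R p).
Proof.
move=> p_pr; have p_gt0 := prime_gt0 p_pr.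
have [k k_prim k_dvd] := prim_order_exists p_gt0 (zeta_exp_order p_gt0).
case/primeP: (p_pr) => _ /(_ k k_dvd) /orP[] /eqP k_eq; last first.
  by rewrite k_eq in k_prim.
have := prim_expr_order k_prim; rewrite k_eq expr1 => /eqP.
by rewrite (negbTE (zeta_neq1 (prime_gt1 p_pr))).
Qed.

End Zeta.

(** * The additive character attached to the trace *)

Section AdditiveCharacter.
Variables (R : realType) (F : finFieldType) (p : nat) (hp : p \in [pchar F]).

Local Notation tr := (absolute_trace hp).
Local Notation L := (pPrimeCharType hp).

Lemma absolute_traceP (a : F) :
  (tr a)%:A = galTrace 1%AS {:L}%AS (a : L) :> L.
Proof. exact/eqP/(xchooseP (galTrace_in_Fp hp a)). Qed.

Lemma absolute_traceD (a b : F) : tr (a + b) = tr a + tr b.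
Proof.
apply: (@fmorph_inj _ _ (in_alg L)); rewrite rmorphD /=.
by rewrite !absolute_traceP; exact: raddfD.
Qed.

(** The trace is the sum of the automorphisms of F over its prime field, which
    are linearly independent by Dedekind's theorem. *)
Lemma absolute_trace_nontrivial : exists a : F, tr a != 0.
Proof.
have [a _] := gal_independent_contra (P := [in 'Gal({:L} / 1)%g])
  (c_ := fun=> 1) (group1 _) (oner_neq0 L).
under eq_bigr do rewrite mul1r.
rewrite -/(galTrace _ _ _) -absolute_traceP => tr_a_neq0.
by exists a; apply: contraNneq tr_a_neq0 => ->; rewrite scale0r.
Qed.

Definition additive_char (a : F) : R[i] := zeta R p ^+ (tr a : nat).

Local Notation psi := additive_char.

(** Adding traces as residues in [0, p) may wrap around p, which zeta ^+ p = 1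
    absorbs. *)
Lemma additive_charD a b : psi (a + b) = psi a * psi b.
Proof.
have p_pr := pcharf_prime hp.
rewrite /additive_char -exprD absolute_traceD /=.
rewrite -[RHS](expr_mod _ (zeta_exp_order R (prime_gt0 p_pr))).
by congr (_ ^+ (_ %% _)%N); exact: Fp_cast.
Qed.

Lemma additive_char0 : psi 0 = 1.
Proof.
have : psi 0 * psi 0 = psi 0 by rewrite -additive_charD addr0.
have psi0_neq0 : psi 0 != 0.
  have p_pr := pcharf_prime hp.
  apply: expf_neq0; apply: contra_neq (oner_neq0 R[i]) => z0.
  by rewrite -(zeta_exp_order R (prime_gt0 p_pr)) z0 expr0n gtn_eqF ?prime_gt0.
by rewrite -[X in _ = X]mulr1 => /(mulfI psi0_neq0).
Qed.

Lemma additive_char_nontrivial : exists a, psi a != 1.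
Proof.
have p_pr := pcharf_prime hp.
have [a tra_neq0] := absolute_trace_nontrivial; exists a.
rewrite -(prim_order_dvd (zeta_primitive R p_pr)).
have tra_ltp : (tr a < p)%N.
  by have := ltn_ord (tr a); rewrite [X in (_ < X)%N]Fp_cast.
by apply: contraL tra_ltp => /dvdn_leq; rewrite -leqNgt lt0n; apply.
Qed.

(** For b != 0 the map a |-> psi (a * b) is a nontrivial character of the
    additive group: translating by a point where it is not 1 rescales the sum. *)
Lemma sum_additive_char (b : F) :
  \sum_(a : F) psi (a * b) = (#|F| * (b == 0))%:R.
Proof.
have [-> | b_neq0] := eqVneq b 0.
  by under eq_bigr do rewrite mulr0 additive_char0; rewrite sumr_const muln1.
rewrite muln0; have [c psic_neq1] := additive_char_nontrivial.
have shift : psi c * \sum_a psi (a * b) = \sum_a psi (a * b).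
  rewrite mulr_sumr [RHS](reindex_inj (addIr (c / b))).
  by apply: eq_bigr => a _; rewrite -additive_charD mulrDl divfK // addrC.
have /eqP := shift; rewrite -subr_eq0 -[X in _ - X]mul1r -mulrBl mulf_eq0.
by rewrite subr_eq0 (negbTE psic_neq1) => /eqP.
Qed.

End AdditiveCharacter.

(** * Multiplicative characters and their Gauss sums *)

Section MulcharTheory.
Variables (R : realType) (F : finFieldType).
Implicit Types (eta : mulchar R F) (a b : F).

Lemma neq0_unitE a : a != 0 -> exists u : {unit F}, a = val u.
Proof. by rewrite -unitfE => a_unit; exists (FinRing.unit F a_unit). Qed.

Lemma mulchar_extE eta (u : {unit F}) : eta (val u) = mulchar_fun eta u.
Proof. by rewrite /mulchar_ext valK. Qed.

Lemma mulchar_ext0 eta : eta 0 = (mulchar_trivial eta)%:R.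
Proof. by rewrite /mulchar_ext insubF // unitr0. Qed.

Lemma mulchar_ext_neq0 eta a : a != 0 -> eta a != 0.
Proof. by move=> /neq0_unitE[u ->]; rewrite mulchar_extE mulchar_neq0. Qed.

Lemma mulchar_ext1 eta : eta 1 = 1.
Proof.
have e1_neq0 := mulchar_neq0 eta 1%g.
rewrite (mulchar_extE eta 1%g); apply: (mulfI e1_neq0).
by rewrite -mulcharM mulg1 mulr1.
Qed.

Lemma mulchar_trivialE eta a : mulchar_trivial eta -> eta a = 1.
Proof.
move=> eta_triv; have [-> | /neq0_unitE[u ->]] := eqVneq a 0.
  by rewrite mulchar_ext0 eta_triv.
by rewrite mulchar_extE; apply/eqP/(forallP eta_triv).
Qed.

(** Includes the value at 0: there a trivial character is 1 and a nontrivial one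
    is 0, and both are compatible with products. *)
Lemma mulchar_extM eta : {morph eta : a b / a * b}.
Proof.
move=> a b; have [eta_triv | /negbTE eta_nt] := boolP (mulchar_trivial eta).
  by rewrite !mulchar_trivialE // mulr1.
have [-> | /neq0_unitE[u ->]] := eqVneq a 0.
  by rewrite mul0r mulchar_ext0 eta_nt mul0r.
have [-> | /neq0_unitE[v ->]] := eqVneq b 0.
  by rewrite mulr0 mulchar_ext0 eta_nt mulr0.
by rewrite -[_ * _]/(val (u * v)%g) !mulchar_extE mulcharM.
Qed.

Lemma mulchar_extV eta a : eta a^-1 = (eta a)^-1.
Proof.
have [-> | a_neq0] := eqVneq a 0.
  by rewrite invr0 mulchar_ext0; case: mulchar_trivial; rewrite ?invr1 ?invr0.
apply: (mulfI (mulchar_ext_neq0 eta a_neq0)).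
by rewrite -mulchar_extM !divff ?mulchar_ext1 ?mulchar_ext_neq0.
Qed.

Lemma mulchar_extN1_sqr eta : eta (-1) ^+ 2 = 1.
Proof. by rewrite expr2 -mulchar_extM mulrNN mulr1 mulchar_ext1. Qed.

Lemma mulchar_powE eta (s : int) a : a != 0 -> mulchar_pow eta s a = eta a ^ s.
Proof. by move=> /neq0_unitE[u ->]; rewrite !mulchar_extE. Qed.

Lemma sum_mulchar eta : ~~ mulchar_trivial eta -> \sum_a eta a = 0.
Proof.
move=> /forallPn[u]; rewrite -mulchar_extE => etau_neq1.
have shift : eta (val u) * \sum_a eta a = \sum_a eta a.
  rewrite mulr_sumr [RHS](reindex_inj (mulfI (_ : val u != 0))).
    by apply: eq_bigr => a _; rewrite mulchar_extM.
  by rewrite -unitfE (valP u).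
have /eqP := shift; rewrite -subr_eq0 -[X in _ - X]mul1r -mulrBl mulf_eq0.
by rewrite subr_eq0 (negbTE etau_neq1) => /eqP.
Qed.

Variables (p : nat) (hp : p \in [pchar F]).
Local Notation psi := (additive_char R hp).
Local Notation G := (gauss_sum hp).

(** For b != 0 substitute a / b for a. For b = 0 both sides vanish, because
    eta 0 = 0 has inverse 0. *)
Lemma twisted_gauss_sum eta b : ~~ mulchar_trivial eta ->
  \sum_a eta a * psi (a * b) = (eta b)^-1 * G eta.
Proof.
move=> eta_nt; have [-> | b_neq0] := eqVneq b 0.
  rewrite mulchar_ext0 (negbTE eta_nt) invr0 mul0r -[RHS](sum_mulchar eta_nt).
  by apply: eq_bigr => a _; rewrite mulr0 additive_char0 mulr1.
rewrite mulr_sumr [RHS](reindex_inj (mulIf b_neq0)); apply: eq_bigr => a _.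
by rewrite mulchar_extM mulrA (mulrCA _ (eta a)) mulVf ?mulr1 ?mulchar_ext_neq0.
Qed.

(** Fourier inversion of eta on the additive group, evaluated at 1: the
    transform of eta is a multiple of G eta at every point, while eta 1 = 1 is
    not 0. *)
Lemma gauss_sum_neq0 eta : ~~ mulchar_trivial eta -> G eta != 0.
Proof.
move=> eta_nt; apply/eqP => G0.
have : \sum_b psi (- b) * \sum_a eta a * psi (a * b) = #|F|%:R.
  under eq_bigr do rewrite mulr_sumr.
  rewrite exchange_big /= (bigD1 1) //= [X in _ + X]big1 => [|a a_neq1].
    under eq_bigr do rewrite mulchar_ext1 mul1r mul1r -additive_charD addNr
      additive_char0.
    by rewrite addr0 sumr_const.
  transitivity (eta a * \sum_b psi (b * (a - 1))).
    rewrite mulr_sumr; apply: eq_bigr => b _.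
    by rewrite mulrCA -additive_charD mulrBr mulr1 (mulrC b) [in RHS]addrC.
  by rewrite sum_additive_char subr_eq0 (negbTE a_neq1) muln0 mulr0.
rewrite big1 => [/esym/eqP | b _]; last first.
  by rewrite twisted_gauss_sum // G0 !mulr0.
by rewrite pnatr_eq0 -leqn0 leqNgt (cardD1 0).
Qed.

End MulcharTheory.

(** * Characters of order m and the group of m-th powers *)

Section OrderM.
Variables (R : realType) (F : finFieldType) (m : nat) (chi : mulchar R F).
Hypothesis chi_order : mulchar_has_order chi m.

Local Notation H := (nz_powers F m).

Let m_gt0 : (0 < m)%N. Proof. by case: chi_order. Qed.

Lemma mulchar_exp_order a : a != 0 -> chi a ^+ m = 1.
Proof.
case: chi_order => _ chim_triv _ a_neq0.
by have := mulchar_powE chi m a_neq0; rewrite mulchar_trivialE.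
Qed.

Lemma mulchar_pow_nontrivial (k : nat) :
  (0 < k < m)%N -> ~~ mulchar_trivial (mulchar_pow chi k).
Proof. by case: chi_order => _ _; apply. Qed.

(** The exponent may be negative; a character is trivial iff its inverse is. *)
Lemma mulchar_powB_nontrivial (s t : nat) : (s < m)%N -> (t < m)%N -> t != s ->
  ~~ mulchar_trivial (mulchar_pow chi (s%:Z - t%:Z)).
Proof.
move=> lt_sm lt_tm; case: ltngtP => // [lt_ts | lt_st] _.
  rewrite subzn ?(ltnW lt_ts) //; apply: mulchar_pow_nontrivial.
  by rewrite subn_gt0 lt_ts (leq_ltn_trans (leq_subr _ _)).
have : ~~ mulchar_trivial (mulchar_pow chi (t - s)%N).
  apply: mulchar_pow_nontrivial.
  by rewrite subn_gt0 lt_st (leq_ltn_trans (leq_subr _ _)).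
apply: contraNN => /forallP triv; apply/forallP => u.
have /eqP := triv u; rewrite /= -opprB subzn ?(ltnW lt_st) // -invr_expz.
by move/(congr1 GRing.inv); rewrite invrK invr1 => ->.
Qed.

Lemma nz_powersP a :
  reflect (exists2 x : F, x != 0 & a = x ^+ m) (a \in H).
Proof. by apply: (iffP imsetP) => -[x]; rewrite ?inE; exists x; rewrite ?inE. Qed.

Lemma nz_powers_neq0 a : a \in H -> a != 0.
Proof. by case/nz_powersP => x x_neq0 ->; rewrite expf_neq0. Qed.

(** The kernel of chi is H. As F^* is cyclic, chi g has order exactly m for a
    generator g, so chi (g ^+ j) = 1 forces m %| j. *)
Lemma mulchar_eq1 a : a != 0 -> (chi a == 1) = (a \in H).
Proof.
move=> a_neq0; apply/eqP/nz_powersP => [chia1 | [x x_neq0 ->]]; last first.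
  rewrite -(mulchar_exp_order x_neq0).
  by elim: m => [|n IHn]; rewrite ?mulchar_ext1 // !exprS mulchar_extM IHn.
have [g gen_g] := cyclicP (field_unit_group_cyclic [set: {unit F}]%G).
have [u a_u] := neq0_unitE a_neq0.
have chiXn (v : {unit F}) n : mulchar_fun chi (v ^+ n)%g = mulchar_fun chi v ^+ n.
  elim: n => [|n IHn].
    by rewrite expg0 expr0 -mulchar_extE mulchar_ext1.
  by rewrite expgS exprS mulcharM IHn.
have [j u_gj] : exists j, u = (g ^+ j)%g.
  by apply/cycleP; rewrite -gen_g inE.
suff /dvdnP[k j_eq] : (m %| j)%N.
  exists (val (g ^+ k)%g); first by rewrite -unitfE (valP (g ^+ k)%g).
  by rewrite a_u u_gj j_eq expgM FinRing.val_unitX.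
case: (posnP (j %% m)) => [/eqP//|r_gt0].
have /mulchar_pow_nontrivial/negP[] : (0 < j %% m < m)%N by rewrite r_gt0 ltn_mod.
apply/forallP => v; have [i ->] : exists i, v = (g ^+ i)%g.
  by apply/cycleP; rewrite -gen_g inE.
apply/eqP; rewrite /= -exprnP chiXn -exprM mulnC exprM.
suff -> : mulchar_fun chi g ^+ (j %% m) = 1 by rewrite expr1n.
have chig_m : mulchar_fun chi g ^+ m = 1.
  by rewrite -mulchar_extE mulchar_exp_order // -unitfE (valP g).
by rewrite expr_mod // -chiXn -u_gj -mulchar_extE -a_u.
Qed.

Lemma sum_mulchar_powers a : a != 0 ->
  \sum_(0 <= t < m) chi a ^+ t = (m * (a \in H))%:R.
Proof.
move=> a_neq0; rewrite -(mulchar_eq1 a_neq0) big_mkord.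
have [-> | chia_neq1] := eqVneq (chi a) 1.
  by under eq_bigr do rewrite expr1n; rewrite sumr_const card_ord muln1.
apply: (mulfI (_ : chi a - 1 != 0)); first by rewrite subr_eq0.
by rewrite -subrX1 mulchar_exp_order // subrr muln0 mulr0.
Qed.

(** Sum the indicator of [sum_mulchar_powers] over F^*: every chi^t with
    0 < t < m sums to 0, so only t = 0 contributes. *)
Lemma card_nz_powers : (m * #|H|)%N = #|F|.-1.
Proof.
apply/eqP; rewrite -(eqr_nat R[i]).
have -> : (m * #|H|)%:R = \sum_(a : F | a != 0) \sum_(0 <= t < m) chi a ^+ t.
  rewrite (eq_bigr _ sum_mulchar_powers) -natr_sum -big_distrr /= -sum1_card.
  congr (_ * _)%:R; rewrite big_mkcond [RHS]big_mkcond; apply: eq_bigr => a _.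
  by have [->|//] := eqVneq a 0; case: ifP => // /nz_powers_neq0; rewrite eqxx.
rewrite exchange_big big_ltn //= [X in _ + X]big_nat [X in _ + X]big1 => [|t t_bnd].
  under eq_bigr do rewrite expr0; rewrite addr0 sumr_const.
  by rewrite -(cardC1 (0 : F)).
have chit_nt := mulchar_pow_nontrivial t_bnd.
rewrite -[RHS](sum_mulchar chit_nt) [RHS](bigD1 0) //= mulchar_ext0.
by rewrite (negbTE chit_nt) add0r; apply: eq_bigr => a /mulchar_powE ->.
Qed.

(** Both sides are the double sum over a and t < m of N a * chi (b / a) ^+ t.
    Summing over t first leaves the a in b H, where N a = N b; summing over a
    first leaves t = 0, the other terms being multiples of vanishing
    coefficients. *)
Lemma nz_powers_fourier_inversion (N : F -> R[i]) b :
    (forall a h, h \in H -> N (a * h) = N a) ->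
    (forall s : nat, (0 < s < m)%N ->
       \sum_a N a * (mulchar_pow chi s a)^-1 = 0) ->
  b != 0 -> #|F|.-1%:R * N b = \sum_(a | a != 0) N a.
Proof.
move=> N_inv N_hat b_neq0.
transitivity (\sum_(a | a != 0) \sum_(0 <= t < m) N a * chi (b / a) ^+ t).
  under eq_bigr => a a_neq0.
    rewrite -mulr_sumr sum_mulchar_powers ?mulf_neq0 ?invr_neq0 //.
    over.
  rewrite -card_nz_powers natrM -mulrA -sum1_card natr_sum mulr_suml mulr_sumr /=.
  rewrite (reindex (fun x => b / x)) /=; last first.
    exists (fun x => b / x) => x _; rewrite invf_div mulrC divfK //.
  rewrite big_mkcond /= [RHS]big_mkcond; apply: eq_bigr => a _.
  have [->|a_neq0] := eqVneq a 0.
    by rewrite invr0 mulr0; case: ifP => // /nz_powers_neq0; rewrite eqxx.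
  case: ifP => baH; last by rewrite muln0 mulr0.
  rewrite mul1r muln1 mulrC; congr (_ * _).
  by rewrite -(N_inv a (b / a) baH) mulrC divfK.
rewrite exchange_big big_ltn //= [X in _ + X]big_nat [X in _ + X]big1 => [|t t_bnd].
  by under eq_bigr do rewrite expr0 mulr1; rewrite addr0.
transitivity (chi b ^+ t * \sum_a N a / mulchar_pow chi t a); last first.
  by rewrite N_hat // mulr0.
rewrite mulr_sumr [RHS](bigD1 0) //=.
rewrite mulchar_ext0 (negbTE (mulchar_pow_nontrivial t_bnd)) invr0 !mulr0 add0r.
apply: eq_bigr => a a_neq0; rewrite mulchar_powE // -exprnP mulrCA.
by rewrite mulchar_extM mulchar_extV exprMn exprVn.
Qed.

Variables (p : nat) (hp : p \in [pchar F]).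
Local Notation psi := (additive_char R hp).
Local Notation G := (gauss_sum hp).

(** The Gauss sum over F^* only. It differs from the full one just at the
    trivial character, where the full sum is 0; leaving out 0 makes every
    coefficient a genuine power of chi a, so that the sum over t in
    [unit_gauss_sum_convolution] is geometric. *)
Definition unit_gauss_sum (s : int) : R[i] :=
  \sum_(a | a != 0) chi a ^ s * psi a.

Lemma unit_gauss_sumE s : ~~ mulchar_trivial (mulchar_pow chi s) ->
  unit_gauss_sum s = G (mulchar_pow chi s).
Proof.
move=> chis_nt; rewrite /gauss_sum (bigD1 0) //= mulchar_ext0 (negbTE chis_nt).
by rewrite mul0r add0r; apply: eq_bigr => a /mulchar_powE ->.
Qed.

Lemma unit_gauss_sum0 : unit_gauss_sum 0 = - 1.
Proof.
apply/eqP; rewrite -subr_eq0 opprK addrC; apply/eqP.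
transitivity (\sum_(a : F) psi (a * 1)); last first.
  by rewrite sum_additive_char oner_eq0 muln0.
rewrite [RHS](bigD1 0) //= mulr1 additive_char0; congr (_ + _).
by apply: eq_bigr => a _; rewrite expr0z mul1r mulr1.
Qed.

(** The sum A_s of the opening comment; the term h = 1 is the inverse of 0, that
    is, 0. *)
Definition shifted_power_sum (s : nat) : R[i] :=
  \sum_(h in H) (mulchar_pow chi s (1 - h))^-1.

(** The substitution x |-> - (x * y) cancels the sign chi (-1) ^+ t and
    separates t from y, so that summing over t selects the x in H. *)
Lemma unit_gauss_sum_convolution (s : nat) : (0 < s < m)%N ->
  \sum_(0 <= t < m)
    chi (-1) ^+ t * unit_gauss_sum t * unit_gauss_sum (s%:Z - t%:Z)
  = m%:R * shifted_power_sum s * G (mulchar_pow chi s).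
Proof.
move=> s_bnd; pose eta := mulchar_pow chi s.
have eta_nt : ~~ mulchar_trivial eta := mulchar_pow_nontrivial s_bnd.
transitivity (\sum_(0 <= t < m) \sum_(y : F | y != 0) \sum_(x | x != 0)
   chi x ^+ t * (eta y * psi (y * (1 - x)))).
  apply: eq_bigr => t _; rewrite mulr_sumr; apply: eq_bigr => y y_neq0.
  have negmul_inj : injective (fun x => - (x * y)).
    by move=> x x' /oppr_inj/(mulIf y_neq0).
  rewrite mulr_sumr mulr_suml (reindex_inj negmul_inj) /=.
  apply: eq_big => x; first by rewrite oppr_eq0 mulf_eq0 (negbTE y_neq0) orbF.
  move=> _; rewrite /eta !mulchar_powE // -exprnP expfzDr ?mulchar_ext_neq0 //.
  rewrite -invr_expz -!exprnP.
  have -> : psi (y * (1 - x)) = psi (- (x * y)) * psi y.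
    by rewrite -additive_charD mulrBr mulr1 addrC (mulrC y).
  have -> : chi (- (x * y)) = chi (-1) * chi x * chi y.
    by rewrite -!mulchar_extM mulN1r mulNr.
  have chiy_t : chi y ^+ t != 0 by rewrite expf_neq0 ?mulchar_ext_neq0.
  have N1_t : chi (-1) ^+ t * chi (-1) ^+ t = 1.
    by rewrite -exprMn -expr2 mulchar_extN1_sqr expr1n.
  rewrite !exprMn !(mulrA (chi (-1) ^+ t)) N1_t mul1r.
  by field.
rewrite exchange_big /=.
under eq_bigr do rewrite exchange_big /=.
rewrite exchange_big /=.
under eq_bigr => x x_neq0.
  under eq_bigr do rewrite -mulr_suml sum_mulchar_powers //.
  over.
rewrite /shifted_power_sum -mulrA mulr_suml mulr_sumr.
rewrite big_mkcond [RHS]big_mkcond; apply: eq_bigr => x _ /=.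
have [->|x_neq0] := eqVneq x 0.
  by case: ifP => // /nz_powers_neq0; rewrite eqxx.
rewrite -mulr_sumr /=; case: ifP => _; last by rewrite muln0 mul0r.
rewrite muln1; congr (_ * _); rewrite -(twisted_gauss_sum hp (1 - x) eta_nt).
by rewrite [RHS](bigD1 0) //= mulchar_ext0 (negbTE eta_nt) mul0r add0r.
Qed.

(** The excluded indices t = 0 and t = s are those where a factor is the sum -1
    of the trivial character over F^*. *)
Lemma gauss_sum_convolution (s : nat) : (0 < s < m)%N ->
  \sum_(1 <= t < m | t != s)
    mulchar_pow chi t (-1) * G (mulchar_pow chi t)
      * G (mulchar_pow chi (s%:Z - t%:Z))
  = (m%:R * shifted_power_sum s + 1 + mulchar_pow chi s (-1))
      * G (mulchar_pow chi s).
Proof.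
move=> s_bnd; have /andP[s_gt0 s_ltm] := s_bnd.
have N1_neq0 : -1 != 0 :> F by rewrite oppr_eq0 oner_eq0.
rewrite !mulrDl mul1r -unit_gauss_sum_convolution // big_ltn // expr0 mul1r subr0.
rewrite unit_gauss_sum0 unit_gauss_sumE ?mulchar_pow_nontrivial // mulN1r.
rewrite (bigD1_seq s) ?mem_index_iota ?iota_uniq ?s_gt0 //= subrr.
rewrite unit_gauss_sum0 unit_gauss_sumE ?mulchar_pow_nontrivial //.
rewrite (mulchar_powE chi s N1_neq0) -exprnP mulrN1.
set g := G _; set c := chi _ ^+ s.
rewrite [RHS](_ : _ = \sum_(1 <= t < m | t != s)
  chi (-1) ^+ t * unit_gauss_sum t * unit_gauss_sum (s%:Z - t%:Z)); last by ring.
rewrite big_nat_cond [RHS]big_nat_cond; apply: eq_bigr => t.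
case/andP=> /andP[t_gt0 t_ltm] t_neqs.
rewrite !unit_gauss_sumE ?mulchar_powE ?mulchar_pow_nontrivial ?t_gt0 //.
exact: mulchar_powB_nontrivial.
Qed.

End OrderM.

(** * Counting differences *)

Section DifferenceCount.
Variables (F : finFieldType) (D : {set F}).

Definition difference_count (a : F) : nat :=
  #|[set xy in setX D D | xy.1 - xy.2 == a]|.

Lemma sum_difference_count (C : comNzRingType) (g : F -> C) :
  \sum_a (difference_count a)%:R * g a = \sum_(x in D) \sum_(y in D) g (x - y).
Proof.
rewrite pair_big /= (partition_big (fun xy : F * F => xy.1 - xy.2) predT) //=.
apply: eq_bigr => a _; rewrite /difference_count -sum1_card natr_sum mulr_suml.
by apply: eq_big => [xy | xy]; rewrite !inE // => /andP[_ /eqP->]; rewrite mul1r.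
Qed.

Lemma difference_count_scale (a h : F) : h != 0 ->
  (forall x, (x * h \in D) = (x \in D)) ->
  difference_count (a * h) = difference_count a.
Proof.
move=> h_neq0 D_h; pose scale (xy : F * F) := (xy.1 * h, xy.2 * h).
have scale_inj : injective scale.
  by move=> [x y] [x' y'] [/(mulIf h_neq0)-> /(mulIf h_neq0)->].
have scale_bij : bijective scale := injF_bij scale_inj.
rewrite /difference_count -(on_card_preimset (onW_bij _ scale_bij)).
apply: eq_card => xy; rewrite !inE /= !D_h -mulrBl; congr (_ && _).
exact: (inj_eq (mulIf h_neq0)).
Qed.

Lemma sum_difference_count_neq0 :
  (\sum_(a : F | a != 0%R) difference_count a = #|D| * #|D|.-1)%N.
Proof.
apply/eqP; rewrite -(eqr_nat int) natr_sum; apply/eqP.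
transitivity (\sum_(a : F) (difference_count a)%:R * (a != 0)%:R : int).
  rewrite big_mkcond; apply: eq_bigr => a _.
  by case: ifP => _; rewrite ?mulr1 ?mulr0.
rewrite sum_difference_count natrM mulr_natl -sumr_const.
apply: eq_bigr => x xD; rewrite (cardsD1 x D) xD /= -sum1_card natr_sum.
rewrite (bigD1 x) //= subrr eqxx add0r.
apply: eq_big => [y | y /andP[_ y_neqx]]; first by rewrite !inE andbC.
by rewrite subr_eq0 eq_sym y_neqx.
Qed.

End DifferenceCount.

(** * Differences of m-th powers *)

Section PowerDifferences.
Variables (R : realType) (F : finFieldType) (m : nat) (chi : mulchar R F).
Hypothesis chi_order : mulchar_has_order chi m.

Local Notation H := (nz_powers F m).
Local Notation D := (powers F m).

Lemma mem_nz_powersM x h : h \in H -> (x * h \in H) = (x \in H).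
Proof.
move=> hH; have h_neq0 := nz_powers_neq0 hH.
have [->|x_neq0] := eqVneq x 0; first by rewrite mul0r.
have chih : chi h = 1 by apply/eqP; rewrite (mulchar_eq1 chi_order).
by rewrite -!(mulchar_eq1 chi_order) ?mulf_neq0 // mulchar_extM chih mulr1.
Qed.

Lemma mem_powersM x h : h \in H -> (x * h \in D) = (x \in D).
Proof.
move=> hH; rewrite !inE mem_nz_powersM // mulf_eq0.
by rewrite (negbTE (nz_powers_neq0 hH)) orbF.
Qed.

Lemma zero_notin_nz_powers : 0 \notin H.
Proof. by apply/negP => /nz_powers_neq0; rewrite eqxx. Qed.

Lemma card_powers : #|D| = #|H|.+1.
Proof. by rewrite cardsU1 zero_notin_nz_powers. Qed.

Lemma sum_powers (g : F -> R[i]) : \sum_(x in D) g x = g 0 + \sum_(x in H) g x.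
Proof. by rewrite big_setU1 ?zero_notin_nz_powers. Qed.

(** Pairs in H x H contribute #|H| times the sum over h of chi^(-s)(1 - h),
    after y = x * h and because chi is 1 on H; the pairs (x, 0) and (0, y)
    contribute #|H| and #|H| * chi^s(-1). *)
Lemma difference_count_fourier (s : nat) : (0 < s < m)%N ->
  \sum_a (difference_count D a)%:R * (mulchar_pow chi s a)^-1
  = #|H|%:R * (shifted_power_sum m chi s + 1 + mulchar_pow chi s (-1)).
Proof.
move=> s_bnd; have eta_nt := mulchar_pow_nontrivial chi_order s_bnd.
rewrite sum_difference_count; set eta := mulchar_pow chi s in eta_nt *.
have etaH h : h \in H -> eta h = 1.
  move=> hH; rewrite mulchar_powE ?(nz_powers_neq0 hH) // -exprnP.
  suff -> : chi h = 1 by rewrite expr1n.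
  by apply/eqP; rewrite (mulchar_eq1 chi_order) ?(nz_powers_neq0 hH).
have eta_VN1 : (eta (-1))^-1 = eta (-1).
  by rewrite -mulchar_extV invrN1.
rewrite sum_powers sum_powers subrr mulchar_ext0 (negbTE eta_nt) invr0 add0r.
rewrite [LHS]addrC mulrDr !mulr_natl; congr (_ + _).
  transitivity (\sum_(x in H) (shifted_power_sum m chi s + 1)).
    apply: eq_bigr => x xH; rewrite sum_powers subr0 etaH // invr1 addrC.
    congr (_ + _).
    rewrite (reindex_inj (mulfI (nz_powers_neq0 xH))) /=.
    apply: eq_big => [h | h _]; first by rewrite mulrC mem_nz_powersM.
    by rewrite -[X in X - _]mulr1 -mulrBr mulchar_extM etaH // mul1r.
  by rewrite sumr_const.
rewrite -sumr_const; apply: eq_bigr => y yH.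
by rewrite sub0r -[- y]mulN1r mulchar_extM (etaH y yH) mulr1 eta_VN1.
Qed.

End PowerDifferences.

Local Open Scope ring_scope.

Theorem theorem3p6 (R : realType) (F : finFieldType) (p q m f lam : nat)
    (hp : p \in [pchar F]) (hF : #|F| = q) (hm : (0 < m)%N) (hf : (0 < f)%N)
    (hq : q = (m * f + 1)%N) (hlam : (f + 1)%N = (lam * m)%N)
    (chi : mulchar R F) (hchi : mulchar_has_order chi m) :
  is_difference_set q (f + 1) lam (powers F m) <->
  (forall s : nat, (1 <= s <= m.-1)%N ->
     \sum_(1 <= t < m | t != s)
        mulchar_pow chi t (-1) * gauss_sum hp (mulchar_pow chi t)
          * gauss_sum hp (mulchar_pow chi (s%:Z - t%:Z))
     = (1 - m%:R) * (1 + mulchar_pow chi s (-1))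
         * gauss_sum hp (mulchar_pow chi s)).
Proof.
have cardH : #|nz_powers F m| = f.
  apply/eqP; rewrite -(eqn_pmul2l hm) (card_nz_powers hchi) hF hq addn1.
  exact: eqxx.
have cardD : #|powers F m| = (f + 1)%N by rewrite card_powers cardH addn1.
pose N := difference_count (powers F m).
have identityP (s : nat) : (0 < s < m)%N ->
    \sum_a (N a)%:R * (mulchar_pow chi s a)^-1 = 0 <->
    \sum_(1 <= t < m | t != s)
        mulchar_pow chi t (-1) * gauss_sum hp (mulchar_pow chi t)
          * gauss_sum hp (mulchar_pow chi (s%:Z - t%:Z))
     = (1 - m%:R) * (1 + mulchar_pow chi s (-1))
         * gauss_sum hp (mulchar_pow chi s).
  move=> s_bnd; rewrite difference_count_fourier // gauss_sum_convolution // cardH.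
  set A := shifted_power_sum _ _ _; set e := mulchar_pow chi s (-1).
  have G_neq0 := gauss_sum_neq0 hp (mulchar_pow_nontrivial hchi s_bnd).
  have m_neq0 : m%:R != 0 :> R[i] by rewrite pnatr_eq0 -lt0n.
  have f_neq0 : f%:R != 0 :> R[i] by rewrite pnatr_eq0 -lt0n.
  split=> [/eqP | /(mulIf G_neq0)/eqP].
    rewrite mulf_eq0 (negbTE f_neq0) -addrA addr_eq0 => /eqP ->.
    by congr (_ * _); ring.
  rewrite -subr_eq0.
  have -> : m%:R * A + 1 + e - (1 - m%:R) * (1 + e) = m%:R * (A + 1 + e) by ring.
  by rewrite mulf_eq0 (negbTE m_neq0) => /eqP ->; rewrite mulr0.
have s_bndE (s : nat) : (1 <= s <= m.-1)%N = (0 < s < m)%N.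
  by rewrite -[(s <= _)%N]ltnS (prednK hm).
split=> [[_ _ N_lam] s | identity].
  rewrite s_bndE => s_bnd; apply/(identityP s s_bnd).
  have eta_nt := mulchar_pow_nontrivial hchi s_bnd.
  transitivity (lam%:R * \sum_a mulchar_pow chi s a); last first.
    by rewrite sum_mulchar // mulr0.
  rewrite mulr_sumr [RHS](reindex_inj invr_inj); apply: eq_bigr => a _.
  rewrite mulchar_extV; have [-> | a_neq0] := eqVneq a 0.
    by rewrite mulchar_ext0 (negbTE eta_nt) invr0 !mulr0.
  by rewrite /N /difference_count N_lam.
split=> // b b_neq0; apply/eqP.
have inversion : ((m * f) * N b)%N = ((f + 1) * f)%N.
  apply/eqP; rewrite -(eqr_nat R[i]) natrM; apply/eqP.
  have -> : (m * f)%N = #|F|.-1 by rewrite hF hq addn1.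
  have -> : ((f + 1) * f)%N = (\sum_(a : F | a != 0%R) N a)%N.
    by rewrite sum_difference_count_neq0 cardD addn1.
  rewrite natr_sum.
  apply: (nz_powers_fourier_inversion hchi (N := fun a => (N a)%:R)) => //.
    move=> a h hH; rewrite /N difference_count_scale ?(nz_powers_neq0 hH) //.
    by move=> x; rewrite (mem_powersM hchi).
  by move=> s s_bnd; apply/(identityP s s_bnd)/identity; rewrite s_bndE.
rewrite -(eqn_pmul2l (_ : 0 < m * f)%N) ?muln_gt0 ?hm //; apply/eqP.
by rewrite [LHS]inversion hlam [RHS]mulnC mulnA.
Qed.
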